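(* Let $e \equiv a_1 x_1 + \dots + a_n x_n$ with integer coefficients $a_i>0$, and integer lower bounds $m_i$ for the variables $x_i$. Let $M = [x_{i_1} = d_{i_1}, \dots, x_{i_n} = d_{i_n}]$ be the matching produced by the greedy procedure $\mathtt{calculateImprovedMinimum}$ (described in the context) applied to $e$, and $\min^*(e) = \sum_{j=1}^n a_{i_j} d_{i_j}$. For each $j \in \{1,\dots,n\}$ let $e_{x_{i_j}}$ denote the expression obtained from $e$ by removing the monomial $a_{i_j} x_{i_j}$, let $M_j$ be the matching produced by the same procedure applied to $e_{x_{i_j}}$ (with the same lower bounds for the remaining variables), let $\min^*(e_{x_{i_j}})$ be the sum of the coefficients times the assigned values in $M_j$, and let $c_j = \min^*(e) - \min^*(e_{x_{i_j}})$. Then: if $x_{i_j}$ was the only candidate for the value $d_{i_j}$ when the procedure was run on $e$, then $M_j$ is obtained from $M$ by deleting the assignment $x_{i_j} = d_{i_j}$, and $c_j = a_{i_j} d_{i_j}$; otherwise, if $x_{i_l}$ was the second best candidate for $d_{i_j}$ (in which case $l > j$), then $M_j$ is obtained from $M_l$ by replacing the assignment $x_{i_j} = d_{i_j}$ with $x_{i_l} = d_{i_j}$, and $c_j = (a_{i_j} - a_{i_l}) d_{i_j} + c_l$.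
   Context: The greedy procedure $\mathtt{calculateImprovedMinimum}$, given a linear expression $f$ with positive coefficients and integer lower bounds for its variables, works as follows. Initially all variables are unassigned, the matching is the empty sequence, and $d := $ (minimum of the lower bounds) $- 1$. Then, as many times as there are variables: let $d$ be the smallest integer strictly greater than the current $d$ for which at least one unassigned variable has lower bound $\le d$ (these unassigned variables are the candidates for $d$); among the candidates choose the one with the greatest coefficient, breaking ties by the smallest index in $f$; mark it assigned and append the assignment (variable $= d$) to the matching. The second best candidate for that value $d$ is, among the candidates for $d$ other than the chosen one, the one with greatest coefficient (ties broken by smallest index); if there is no other candidate, the chosen variable was the only candidate for $d$. For the empty expression the matching is empty and the sum is $0$. *)

(* Defs.v *)
From mathcomp Require Import all_boot all_order all_algebra.
Set Implicit Arguments.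
Unset Strict Implicit.
Unset Printing Implicit Defensive.
Import Order.TTheory GRing.Theory Num.Theory.
Local Open Scope ring_scope.

(* The pair (a, x) is the monomial a * x. An expression is the sequence of its
   monomials in the order in which they are written, so the index of a monomial
   is its position; removing monomials preserves the order of the others. *)
Definition monomial (V : eqType) : Type := (int * V)%type.

Definition coef (V : eqType) (u : monomial V) : int := u.1.
Definition var (V : eqType) (u : monomial V) : V := u.2.

Definition expr (V : eqType) : Type := seq (monomial V).

Definition remove_var (V : eqType) (x : V) (e : expr V) : expr V :=
  [seq u <- e | var u != x].

(* Greatest coefficient, ties broken in favour of the earliest monomial. *)
Fixpoint best (V : eqType) (s : seq (monomial V)) : option (monomial V) :=
  if s is u :: s' then
    if best s' is Some v then Some (if coef v <= coef u then u else v)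
    else Some u
  else None.

(* The value 0 on the empty sequence is junk and is never used. *)
Definition min_bound (V : eqType) (m : V -> int) (s : seq (monomial V)) : int :=
  if s is u :: s' then foldr Num.min (m (var u)) [seq m (var v) | v <- s']
  else 0.

Definition candidates_for (V : eqType) (m : V -> int) (U : seq (monomial V))
    (d : int) : seq (monomial V) :=
  [seq u <- U | m (var u) <= d].

(* The smallest integer strictly greater than d for which some monomial of U is
   a candidate, if U is not empty: see next_valueP. *)
Definition next_value (V : eqType) (m : V -> int) (U : seq (monomial V))
    (d : int) : int :=
  Num.max (d + 1) (min_bound m U).

Record step (V : eqType) : Type := Step {
  chosen : monomial V;
  value : int;
  candidates : seq (monomial V)
}.

(* k iterations from the unassigned monomials U and the current value d. The
   branch None is not reached as long as k <= size U: see size_greedy_run. *)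
Fixpoint greedy_run (V : eqType) (m : V -> int) (k : nat) (d : int)
    (U : seq (monomial V)) : seq (step V) :=
  if k is k'.+1 then
    let d' := next_value m U d in
    let C := candidates_for m U d' in
    if best C is Some u then Step u d' C :: greedy_run m k' d' (rem u U)
    else [::]
  else [::].

Lemma best_mem (V : eqType) (s : seq (monomial V)) u :
  best s = Some u -> u \in s.
Proof.
elim: s u => //= v s IHs u.
case: (best s) IHs => [w IHs|_] [<-]; last exact: mem_head.
by case: ifP => _; rewrite inE ?eqxx // (IHs w) ?orbT.
Qed.

Lemma best_None (V : eqType) (s : seq (monomial V)) :
  (best s == None) = (s == [::]).
Proof. by case: s => //= u s; case: (best s). Qed.

Lemma best_max (V : eqType) (s : seq (monomial V)) u v :
    best s = Some u -> v \in s ->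
  coef v < coef u \/ coef v = coef u /\ (index u s <= index v s)%N.
Proof.
elim: s u v => //= w s IHs u v.
case E: (best s) => [t|] [<-]; last first.
  by move/eqP: E; rewrite best_None => /eqP ->; rewrite inE => /eqP ->; right.
rewrite inE /=; case: (leP (coef t) (coef w)) => [le_tw|lt_wt].
  rewrite eqxx; case/predU1P => [->|vs]; first by right.
  case: (IHs _ _ E vs) => [lt_vt|[-> _]]; first by left; apply: lt_le_trans le_tw.
  by move: le_tw; rewrite le_eqVlt => /orP[/eqP|]; [right | left].
case/predU1P => [->|vs]; first by left.
case: (IHs _ _ E vs) => [|[eq_vt le_tv]]; [by left | right; split=> //].
have [wt|_] := eqVneq w t; first by rewrite wt ltxx in lt_wt.
by have [wv|_] := eqVneq w v; first by rewrite wv eq_vt ltxx in lt_wt.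
Qed.

Lemma min_bound_le (V : eqType) (m : V -> int) (U : seq (monomial V)) u :
  u \in U -> min_bound m U <= m (var u).
Proof.
case: U => //= v U; rewrite inE; elim: U => [|w U IHU] /=.
  by rewrite orbF => /eqP ->.
rewrite inE ge_min => /or3P[uv|/eqP ->|uU]; last 1 first.
- by rewrite IHU ?orbT // uU orbT.
- by rewrite IHU ?orbT // uv.
- by rewrite lexx.
Qed.

Lemma min_bound_mem (V : eqType) (m : V -> int) (U : seq (monomial V)) :
  U != [::] -> has (fun u => m (var u) == min_bound m U) U.
Proof.
case: U => //= v U _; elim: U => [|w U IHU] /=; first by rewrite eqxx.
case: leP => [_|lt_]; first by rewrite eqxx orbT.
by case/orP: IHU => [->|->] //; rewrite !orbT.
Qed.

Lemma next_valueP (V : eqType) (m : V -> int) (U : seq (monomial V)) (d : int) :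
    U != [::] ->
  [/\ d < next_value m U d,
      candidates_for m U (next_value m U d) != [::]
    & forall d', d < d' -> candidates_for m U d' != [::] ->
        next_value m U d <= d'].
Proof.
move=> U0; rewrite /next_value; split=> [||d' lt_d].
- by rewrite lt_max ltzD1 lexx.
- by rewrite -has_filter; apply: sub_has (min_bound_mem m U0) => u /eqP ->;
    rewrite le_max lexx orbT.
rewrite -has_filter => /hasP[u uU le_d'].
by rewrite ge_max lezD1 lt_d (le_trans (min_bound_le m uU)).
Qed.

Lemma size_greedy_run (V : eqType) (m : V -> int) (k : nat) (d : int)
    (U : seq (monomial V)) :
  (k <= size U)%N -> size (greedy_run m k d U) = k.
Proof.
elim: k d U => //= k IHk d U lt_k.
have U0 : U != [::] by case: U lt_k.
have [_ C0 _] := next_valueP m d U0.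
case E: (best _) => [u|]; last by move/eqP: E; rewrite best_None (negPf C0).
move/best_mem: E; rewrite mem_filter => /andP[_ uU] /=.
by rewrite IHk // size_rem // -ltnS prednK //; case: U lt_k {U0 C0 uU}.
Qed.

Lemma size_greedy_run_expr (V : eqType) (m : V -> int) (e : expr V) :
  size (greedy_run m (size e) (min_bound m e - 1) e) == size e.
Proof. by rewrite size_greedy_run. Qed.

(* calculateImprovedMinimum, recording the candidates at each iteration. *)
Definition greedy (V : eqType) (m : V -> int) (e : expr V) :
    (size e).-tuple (step V) :=
  Tuple (size_greedy_run_expr m e).

Definition assignment (V : eqType) (s : step V) : V * int :=
  (var (chosen s), value s).

Definition matching (V : eqType) (m : V -> int) (e : expr V) : seq (V * int) :=
  [seq assignment s | s <- greedy m e].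

Definition min_star (V : eqType) (m : V -> int) (e : expr V) : int :=
  \sum_(s <- greedy m e) coef (chosen s) * value s.

Definition other_candidates (V : eqType) (s : step V) : seq (monomial V) :=
  [seq u <- candidates s | u != chosen s].

Definition only_candidate (V : eqType) (s : step V) : bool :=
  other_candidates s == [::].

Definition second_best (V : eqType) (s : step V) : option (monomial V) :=
  best (other_candidates s).

(* For j : 'I_(size e), which counts from 0: the variable x_{i_j}, the
   expression e_{x_{i_j}} and the difference c_j. *)
Definition greedy_var (V : eqType) (m : V -> int) (e : expr V)
    (j : 'I_(size e)) : V :=
  var (chosen (tnth (greedy m e) j)).

Definition greedy_remove (V : eqType) (m : V -> int) (e : expr V)
    (j : 'I_(size e)) : expr V :=
  remove_var (greedy_var m j) e.

Definition greedy_diff (V : eqType) (m : V -> int) (e : expr V)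
    (j : 'I_(size e)) : int :=
  min_star m e - min_star m (greedy_remove m j).

Definition replace_item (T : eqType) (p q : T) (s : seq T) : seq T :=
  [seq if r == p then q else r | r <- s].

(* Main.v *)
(* Deleting a monomial v changes neither the value nor the choice at a step where
   another monomial is chosen, so the runs with and without v agree until v is
   chosen, at some value d. If v is the only candidate for d, the bounds of the
   other unassigned monomials exceed d, and from there on the next values do not
   depend on whether d has been used. If w is the second best candidate for d,
   the run without v chooses w at d, and the run without w chooses v at d; both
   then continue from the same value with the same unassigned monomials. *)
From HB Require Import structures.
Require Import Defs.
From mathcomp Require Import all_boot all_order all_algebra.
From mathcomp Require Import ring.
Set Implicit Arguments.
Unset Strict Implicit.
Unset Printing Implicit Defensive.
Import Order.TTheory GRing.Theory Num.Theory.
Local Open Scope ring_scope.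

(** Serves only to equip [step V] with an equality, so that membership of a step in a run makes
    sense. *)
Definition step_tuple (V : eqType) (s : step V) :=
  (chosen s, value s, candidates s).

Lemma step_tupleK (V : eqType) :
  cancel (@step_tuple V) (fun t => Step t.1.1 t.1.2 t.2).
Proof. by case. Qed.

HB.instance Definition _ (V : eqType) :=
  Equality.copy (step V) (can_type (@step_tupleK V)).

(** * A single step under deletion of monomials *)

Lemma best_filter (V : eqType) (p : pred (monomial V)) (s : seq (monomial V)) u :
  best s = Some u -> p u -> best (filter p s) = Some u.
Proof.
elim: s u => //= w s IHs u.
case E: (best s) => [v|] [<-]; last first.
  by move/eqP: E; rewrite best_None => /eqP -> /= ->.
case: (leP (coef v) (coef w)) => [le_vw pw|lt_wv pv]; last first.
  by case: (p w) => /=; rewrite (IHs _ E pv) // leNgt lt_wv.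
(* The best [t] of the filtered tail lies in [s], so its coefficient is at most that of [v], hence
   at most that of [w]. *)
rewrite pw /=; case F: (best _) => [t|] //.
have /(best_max E) le_tv : t \in s.
  by have := best_mem F; rewrite mem_filter => /andP[].
suff -> : coef t <= coef w by [].
by apply: le_trans le_vw; case: le_tv => [/ltW|[->]].
Qed.

Lemma min_bound_leP (V : eqType) (m : V -> int) (U : seq (monomial V)) (d : int) :
    U != [::] ->
  (d <= min_bound m U) = all (fun u => d <= m (var u)) U.
Proof.
move=> U0; apply/idP/allP => [le_d u uU|le_d].
  exact: le_trans le_d (min_bound_le m uU).
by have /hasP[u uU /eqP <-] := min_bound_mem m U0; apply: le_d.
Qed.

(** Filtering can only raise the minimum of the bounds, and the surviving candidate [u] keeps it
    from rising above the next value. *)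
Lemma next_value_filter (V : eqType) (m : V -> int) (p : pred (monomial V))
    (U : seq (monomial V)) (d : int) u :
    u \in candidates_for m U (next_value m U d) -> p u ->
  next_value m (filter p U) d = next_value m U d.
Proof.
rewrite mem_filter => /andP[le_u uU] pu.
have upU : u \in filter p U by rewrite mem_filter pu.
have pU0 : filter p U != [::] by apply/eqP => pU0; rewrite pU0 in upU.
have U0 : U != [::] by apply/eqP => U0; rewrite U0 in uU.
apply/eqP; rewrite eq_le {1}/next_value ge_max.
rewrite (le_trans (min_bound_le m upU)) // andbT.
rewrite {1}/next_value le_max lexx /=.
rewrite /next_value ge_max le_max lexx /= le_max min_bound_leP //.
apply/orP; right; apply/allP => v; rewrite mem_filter => /andP[_].
exact: min_bound_le.
Qed.

Lemma candidates_for_filter (V : eqType) (m : V -> int) (p : pred (monomial V))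
    (U : seq (monomial V)) (d : int) :
  candidates_for m (filter p U) d = filter p (candidates_for m U d).
Proof.
by rewrite /candidates_for -!filter_predI; apply: eq_filter => u /=; rewrite andbC.
Qed.

(** * Complete runs from an arbitrary state *)

Definition greedy_from (V : eqType) (m : V -> int) (d : int)
    (U : seq (monomial V)) : seq (step V) :=
  greedy_run m (size U) d U.

Lemma greedy_from_best (V : eqType) (m : V -> int) (d : int)
    (U : seq (monomial V)) u :
    let d' := next_value m U d in
    best (candidates_for m U d') = Some u ->
  greedy_from m d U =
    Step u d' (candidates_for m U d') :: greedy_from m d' (rem u U).
Proof.
move=> d' E; have := best_mem E; rewrite mem_filter => /andP[_ uU].
rewrite /greedy_from (size_rem uU).
by case: U uU @d' E => //= v U _ ->.
Qed.

Lemma best_next (V : eqType) (m : V -> int) (d : int) (U : seq (monomial V)) :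
    U != [::] ->
  exists u, best (candidates_for m U (next_value m U d)) = Some u.
Proof.
move=> U0; have [_ C0 _] := next_valueP m d U0.
case E: (best _) => [u|]; first by exists u.
by move/eqP: E; rewrite best_None (negPf C0).
Qed.

Lemma rem_swap (T : eqType) (x y : T) (s : seq T) :
  uniq s -> rem x (rem y s) = rem y (rem x s).
Proof.
move=> s_uniq; rewrite !rem_filter ?filter_uniq // -!filter_predI.
by apply: eq_filter => z /=; rewrite andbC.
Qed.

(** The choice [u] survives the deletion of [v], so the value and the choice stay the same. Without
    duplicates [rem] is a filter, which brings in the lemmas on filtering. *)
Lemma greedy_from_rem (V : eqType) (m : V -> int) (d : int)
    (U : seq (monomial V)) u v :
    let d' := next_value m U d in
    uniq U -> best (candidates_for m U d') = Some u -> v != u ->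
  greedy_from m d (rem v U) =
    Step u d' (rem v (candidates_for m U d')) :: greedy_from m d' (rem v (rem u U)).
Proof.
move=> d' U_uniq E neq_vu; have pu : predC1 v u by rewrite /= eq_sym.
have Ed' := next_value_filter (best_mem E) pu.
rewrite rem_swap // !(rem_filter v) ?filter_uniq //.
by rewrite (@greedy_from_best _ _ _ _ u) Ed' candidates_for_filter // (best_filter E pu).
Qed.

(** Below all bounds, the first value reached is the minimum of the bounds whatever the current
    value is, and from there the runs coincide. *)
Lemma greedy_from_below (V : eqType) (m : V -> int) (d d' : int)
    (U : seq (monomial V)) :
    all (fun u => d < m (var u)) U -> all (fun u => d' < m (var u)) U ->
  greedy_from m d U = greedy_from m d' U.
Proof.
have [-> //|U0] := eqVneq U [::].
have below c : all (fun u => c < m (var u)) U -> next_value m U c = min_bound m U.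
  move=> lt_c; apply/max_idPr; rewrite min_bound_leP //.
  by apply: sub_all lt_c => u; rewrite lezD1.
move=> /below dE /below d'E; have [u] := best_next m d U0.
move=> E; rewrite (greedy_from_best E) (@greedy_from_best _ _ d' _ u).
  by rewrite dE d'E.
by rewrite d'E -dE.
Qed.

Lemma greedy_from_ind (V : eqType) (m : V -> int)
    (P : int -> seq (monomial V) -> Prop) :
    (forall d, P d [::]) ->
    (forall d U u, let d' := next_value m U d in
       best (candidates_for m U d') = Some u -> P d' (rem u U) -> P d U) ->
  forall d U, P d U.
Proof.
move=> P0 PS d U; have [n] := ubnP (size U); elim: n => // n IHn in d U *.
have [-> // | U0 le_Un] := eqVneq U [::].
have [u E] := best_next m d U0; apply: (PS _ _ _ E); apply: IHn.
have := best_mem E; rewrite mem_filter => /andP[_ uU].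
by rewrite size_rem // -ltnS prednK //; case: U uU {U0 E le_Un}.
Qed.

Lemma greedy_from_mem (V : eqType) (m : V -> int) (d : int)
    (U : seq (monomial V)) (s : step V) :
    s \in greedy_from m d U ->
  chosen s \in candidates s /\ {subset candidates s <= U}.
Proof.
move: d U; apply: (greedy_from_ind (m := m)) => // d U u d' E IH.
rewrite (greedy_from_best E) inE => /predU1P[->|/IH[cs sub_s]] /=.
  by split=> [|v]; [apply: best_mem | rewrite mem_filter => /andP[]].
by split=> // v /sub_s /mem_rem.
Qed.

Lemma perm_greedy_from (V : eqType) (m : V -> int) (d : int)
    (U : seq (monomial V)) :
  perm_eq [seq chosen s | s <- greedy_from m d U] U.
Proof.
move: d U; apply: (greedy_from_ind (m := m)) => // d U u d' E IH.
have := best_mem E; rewrite mem_filter => /andP[_ uU].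
by rewrite (greedy_from_best E) perm_sym (permPl (perm_to_rem uU)) /= perm_cons perm_sym.
Qed.

(** Later candidates come from [rem u U], which no longer contains [u]. This will show that a second
    best candidate is chosen later. *)
Lemma greedy_from_pairwise (V : eqType) (m : V -> int) (d : int)
    (U : seq (monomial V)) :
    uniq U ->
  pairwise (fun s t => chosen s \notin candidates t) (greedy_from m d U).
Proof.
move: d U; apply: (greedy_from_ind (m := m)) => // d U u d' E IH U_uniq.
rewrite (greedy_from_best E) /= IH ?rem_uniq // andbT.
apply/allP => s /greedy_from_mem[_ sub_s]; apply/negP => /sub_s.
by rewrite mem_rem_uniqF.
Qed.

(* The chosen monomials carry the coefficients, so that both the matching and
   min_star are functions of the plan. *)
Definition plan (V : eqType) (m : V -> int) (d : int) (U : seq (monomial V)) :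
    seq (monomial V * int) :=
  [seq (chosen s, value s) | s <- greedy_from m d U].

(** * Effect of deleting one monomial on the plan *)

Lemma plan_only_candidate (V : eqType) (m : V -> int) (d : int)
    (U : seq (monomial V)) (s : step V) :
    uniq U -> s \in greedy_from m d U -> only_candidate s ->
  exists P R, plan m d U = P ++ (chosen s, value s) :: R /\
              plan m d (rem (chosen s) U) = P ++ R.
Proof.
move=> U_uniq s_in s_only; move: d U U_uniq s_in.
apply: (greedy_from_ind (m := m)) => // d U u d' E IH U_uniq.
rewrite (greedy_from_best E) inE => /predU1P[s_def|s_in]; last first.
  have neq_su : chosen s != u.
    have [cs sub_s] := greedy_from_mem s_in.
    by have := sub_s _ cs; rewrite mem_rem_uniq // => /andP[].
  have [P [R [PR PR']]] := IH (rem_uniq u U_uniq) s_in.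
  exists ((u, d') :: P), R; rewrite /plan (greedy_from_best E).
  by rewrite (greedy_from_rem U_uniq E neq_su) /= -!/(plan _ _ _) PR PR'.
exists [::], (plan m d' (rem u U)); rewrite /plan (greedy_from_best E) s_def.
split=> //=; congr map.
have above : all (fun v => d' < m (var v)) (rem u U).
  apply/allP => v; rewrite mem_rem_uniq // => /andP[/= neq_vu vU].
  (* A bound at most [d'] would put [v] among the other candidates, of which there are none. *)
  move/eqP/(congr1 (fun r => v \in r)): s_only; rewrite s_def /=.
  by rewrite !mem_filter neq_vu vU andbT /= in_nil ltNge => ->.
apply: greedy_from_below => //; apply: sub_all above => v; apply: lt_trans.
have U0 : U != [::] by case: (U) E.
by case: (next_valueP m d U0).
Qed.

(** Two deletions are compared with each other, not with the full run: after this step both runs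
    have lost the same two monomials, so the tail [R] is common. *)
Lemma plan_second_best (V : eqType) (m : V -> int) (d : int)
    (U : seq (monomial V)) (s : step V) v :
    uniq U -> s \in greedy_from m d U -> second_best s = Some v ->
  exists P R, plan m d (rem v U) = P ++ (chosen s, value s) :: R /\
              plan m d (rem (chosen s) U) = P ++ (v, value s) :: R.
Proof.
move=> U_uniq s_in s_second; move: d U U_uniq s_in.
have := best_mem s_second; rewrite mem_filter => /andP[neq_vs v_cand].
apply: (greedy_from_ind (m := m)) => // d U u d' E IH U_uniq.
rewrite (greedy_from_best E) inE => /predU1P[s_def|s_in]; last first.
  have [cs sub_s] := greedy_from_mem s_in.
  have neq_su : chosen s != u.
    by have := sub_s _ cs; rewrite mem_rem_uniq // => /andP[].
  have neq_vu : v != u.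
    by have := sub_s _ v_cand; rewrite mem_rem_uniq // => /andP[].
  have [P [R [PR PR']]] := IH (rem_uniq u U_uniq) s_in.
  exists ((u, d') :: P), R; rewrite /plan (greedy_from_rem U_uniq E neq_vu).
  by rewrite (greedy_from_rem U_uniq E neq_su) /= -!/(plan _ _ _) PR PR'.
move: s_second neq_vs v_cand; rewrite s_def /second_best /other_candidates /=.
move=> F neq_vu v_cand.
exists [::], (plan m d' (rem v (rem u U))).
rewrite /plan (greedy_from_rem U_uniq E neq_vu) /=; split=> //.
(* [v] is still a candidate at [d'] once [u] is gone, and by [F] it is then the best one. *)
have Ed' : next_value m (rem u U) d = d'.
  by rewrite rem_filter // (next_value_filter v_cand).
rewrite (@greedy_from_best _ _ _ _ v) Ed' //.
by rewrite rem_filter // candidates_for_filter.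
Qed.

(** Since the variables are distinct, deletion by variable removes a single monomial. *)
Lemma rem_var (V : eqType) (U : seq (monomial V)) u :
  uniq [seq var v | v <- U] -> u \in U -> remove_var (var u) U = rem u U.
Proof.
rewrite /remove_var; elim: U => //= w U IHU /andP[wU U_uniq].
rewrite inE eq_sym; have [<- _|neq_wu /= uU] := eqVneq w u.
  rewrite eqxx /=; apply/all_filterP/allP => v vU.
  by apply: contraNneq wU => <-; apply: map_f.
rewrite IHU //; case: eqP => // Ewu.
by rewrite Ewu map_f in wU.
Qed.

(** * From plans to matchings and sums *)

Definition plan_assignment (V : eqType) (p : monomial V * int) : V * int :=
  (var p.1, p.2).

Lemma min_bound_pred_lt (V : eqType) (m : V -> int) (U : seq (monomial V)) :
  all (fun u => min_bound m U - 1 < m (var u)) U.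
Proof. by apply/allP => u uU; rewrite ltrBlDr ltzD1 min_bound_le. Qed.

(** The freedom in [d] allows one starting value for [e] and for its subexpressions, whose minimum
    bounds may differ. *)
Lemma matching_plan (V : eqType) (m : V -> int) (d : int) (e : expr V) :
    all (fun u => d < m (var u)) e ->
  matching m e = [seq plan_assignment p | p <- plan m d e].
Proof.
move=> lt_d; rewrite /matching /plan -map_comp.
by rewrite (greedy_from_below lt_d (min_bound_pred_lt m e)).
Qed.

Lemma min_star_plan (V : eqType) (m : V -> int) (d : int) (e : expr V) :
    all (fun u => d < m (var u)) e ->
  min_star m e = \sum_(p <- plan m d e) coef p.1 * p.2.
Proof.
move=> lt_d; rewrite /min_star /plan big_map.
by rewrite (greedy_from_below lt_d (min_bound_pred_lt m e)).
Qed.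

(** Yields distinct assignments when the variables are distinct, so that deleting or replacing an
    assignment affects one position only. *)
Lemma perm_matching_var (V : eqType) (m : V -> int) (e : expr V) :
  perm_eq [seq p.1 | p <- matching m e] [seq var u | u <- e].
Proof.
rewrite /matching -map_comp (map_comp (@var V) (@chosen V)).
by apply: perm_map; apply: perm_greedy_from.
Qed.

Lemma replace_item_cat (T : eqType) (x y : T) (s1 s2 : seq T) :
  uniq (s1 ++ x :: s2) -> replace_item x y (s1 ++ x :: s2) = s1 ++ y :: s2.
Proof.
rewrite cat_uniq /= negb_or => /and3P[_ /andP[xs1 _] /andP[xs2 _]].
rewrite /replace_item map_cat /= eqxx.
have repl s : x \notin s -> [seq if r == x then y else r | r <- s] = s.
  move=> xs; rewrite -[RHS]map_id; apply/eq_in_map => r rs.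
  by case: eqP => // rx; rewrite -rx rs in xs.
by rewrite !repl.
Qed.

Lemma rem_cat_uniq (T : eqType) (x : T) (s1 s2 : seq T) :
  uniq (s1 ++ x :: s2) -> rem x (s1 ++ x :: s2) = s1 ++ s2.
Proof.
rewrite cat_uniq /= negb_or => /and3P[_ /andP[xs1 _] _].
elim: s1 xs1 => /= [|z s1 IHs1]; first by rewrite eqxx.
by rewrite inE negb_or eq_sym => /andP[/negPf-> /IHs1->].
Qed.

Theorem theorem3p3 (V : eqType) (m : V -> int) (e : expr V)
    (e_uniq : uniq [seq var u | u <- e])
    (e_pos : forall u : monomial V, u \in e -> 0 < coef u)
    (j : 'I_(size e)) :
  let s := tnth (greedy m e) in
  [/\ only_candidate (s j) ->
        matching m (greedy_remove m j) = rem (assignment (s j)) (matching m e)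
        /\ greedy_diff m j = coef (chosen (s j)) * value (s j),
      ~~ only_candidate (s j) ->
        exists l : 'I_(size e), second_best (s j) = Some (chosen (s l))
    & forall l : 'I_(size e), second_best (s j) = Some (chosen (s l)) ->
        [/\ (j < l)%N,
            assignment (s j) \in matching m (greedy_remove m l),
            matching m (greedy_remove m j) =
              replace_item (assignment (s j)) (var (chosen (s l)), value (s j))
                (matching m (greedy_remove m l))
          & greedy_diff m j =
              (coef (chosen (s j)) - coef (chosen (s l))) * value (s j)
              + greedy_diff m l]].
Proof.
move=> s; have U_uniq := map_uniq e_uniq.
pose d := min_bound m e - 1.
have s_in k : s k \in greedy_from m d e by apply: (mem_tnth k (greedy m e)).
have [cs_in sub_s] := greedy_from_mem (s_in j).
have above : all (fun u => d < m (var u)) e := min_bound_pred_lt m e.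
have removeE k : greedy_remove m k = rem (chosen (s k)) e.
  apply: rem_var => //; have [ck sub_k] := greedy_from_mem (s_in k).
  exact: sub_k.
have above_rem u : all (fun u => d < m (var u)) (rem u e).
  by apply/allP => v /mem_rem; apply: (allP above).
have matching_uniq f : subseq f e -> uniq (matching m f).
  move=> sub_f; apply: (map_uniq (f := fst)).
  rewrite (perm_uniq (perm_matching_var m f)).
  by apply: subseq_uniq e_uniq; apply: map_subseq.
split=> [only|nonly|l second].
- have [P [R [PR PR']]] := plan_only_candidate U_uniq (s_in j) only.
  rewrite /greedy_diff removeE (matching_plan (above_rem _)) (matching_plan above).
  rewrite (min_star_plan (above_rem _)) (min_star_plan above) PR PR'.
  split; last by rewrite !big_cat big_cons /= addrCA addrK.
  have := matching_uniq e (subseq_refl e).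
  by rewrite (matching_plan above) PR !map_cat /= => /rem_cat_uniq ->.
- case E: (second_best (s j)) => [v|]; last first.
    by move/eqP: E nonly; rewrite best_None /only_candidate => ->.
  have := best_mem E; rewrite mem_filter => /andP[_ /sub_s].
  (* The chosen monomials are a permutation of [e], so the second best one is itself chosen at some
     step [l]. *)
  rewrite -(perm_mem (perm_greedy_from m d e)) => /mapP[t t_in ->].
  by have /tnthP[l ->] : t \in greedy m e by []; exists l.
- have := best_mem second; rewrite mem_filter => /andP[neq_lj l_cand].
  have [P [R [PR PR']]] := plan_second_best U_uniq (s_in j) second.
  rewrite /greedy_diff !removeE !(matching_plan (above_rem _)).
  rewrite !(min_star_plan (above_rem _)) PR PR'.
  have l_uniq := matching_uniq _ (rem_subseq (chosen (s l)) e).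
  rewrite (matching_plan (above_rem _)) PR map_cat /= in l_uniq.
  split.
  (* The second best monomial differs from the one chosen at [j], and being a candidate at [j] it
     was not chosen earlier. *)
  + rewrite ltn_neqAle leqNgt; apply/andP; split.
      by apply: contraNneq neq_lj => /val_inj ->.
    apply/negP => lt_lj.
    have /(pairwiseP (s j)) := greedy_from_pairwise m d U_uniq.
    have size_r : size (greedy_from m d e) = size e := size_tuple (greedy m e).
    move/(_ l j); rewrite !inE size_r !ltn_ord => /(_ isT isT lt_lj).
    by rewrite -!(tnth_nth (s j) (greedy m e)) l_cand.
  + by rewrite map_cat mem_cat mem_head orbT.
  + by rewrite !map_cat /= replace_item_cat.
  (* [min_star m e] stays unexpanded and cancels; the sums for the two deletions differ in one
     term. *)
  + by rewrite !big_cat !big_cons /=; ring.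
Qed.
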